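(* Let $(\lambda_j)_{j\ge 1}$ and $(\alpha_j)_{j\ge 1}$ be two sequences of real numbers such that $\lambda_j>0$ for all but at most finitely many $j$, and $\sum_{j=1}^{\infty}|\alpha_j|<+\infty$. Define $$\varphi(t)=\sum_{j=1}^{\infty}\alpha_j e^{-\lambda_j t},\qquad t\ge 0 .$$ Then $\varphi$ is real analytic on $(0,+\infty)$. More precisely, for every $\tau>0$, $$\varphi(t)=\sum_{n=0}^{\infty} b_n (t-\tau)^n\quad\text{for all } t\in(0,2\tau),\qquad\text{where}\quad b_n=\sum_{j=1}^{\infty}\alpha_j e^{-\lambda_j\tau}\frac{(-\lambda_j)^n}{n!}.$$ Furthermore, for every $\tau>0$ and every $t\in(0,2\tau)$, $$\left|\varphi(t)-\sum_{j=0}^{n} b_j (t-\tau)^j\right| = O\!\left(\frac{|t-\tau|^n}{\tau^n\sqrt{n}}\right)\quad\text{as } n\to+\infty .$$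
   Context: The convention $0^0=1$ is used. A function is real analytic on an open interval if near each point of the interval it equals the sum of a convergent power series centered at that point. The $O$ is for $n\to+\infty$ with $t$ and $\tau$ fixed. *)

(* Defs.v *)
From Stdlib Require Import Reals Factorial List.
From Coquelicot Require Import Coquelicot.
Open Scope R_scope.

(* Sequences (x_j)_{j >= 1} are encoded as nat -> R with index shifted by one:
   x_j is [x (j - 1)]. *)

(* Only meaningful where the series converges ([Series] is total). *)
Definition phi (alpha lambda : nat -> R) (t : R) : R :=
  Series (fun j => alpha j * exp (- lambda j * t)).

(* [pow] satisfies 0 ^ 0 = 1, which matters when some lambda_j = 0. *)
Definition taylor_term (alpha lambda : nat -> R) (tau : R) (n j : nat) : R :=
  alpha j * exp (- lambda j * tau) * ((- lambda j) ^ n / INR (fact n)).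

Definition taylor_coef (alpha lambda : nat -> R) (tau : R) (n : nat) : R :=
  Series (taylor_term alpha lambda tau n).

Definition real_analytic_on (a b : Rbar) (f : R -> R) : Prop :=
  forall x0 : R, Rbar_lt a x0 -> Rbar_lt x0 b ->
    exists c : nat -> R, locally x0 (fun x => is_pseries c (x - x0) (f x)).

Definition bigO_seq (u v : nat -> R) : Prop :=
  exists C : R, eventually (fun n => Rabs (u n) <= C * Rabs (v n)).

(* Main.v *)
Require Import Defs.
From Stdlib Require Import Reals Factorial List Lra Lia.
From Coquelicot Require Import Coquelicot.
Open Scope R_scope.

(** Put s = t - tau and x_j = - lambda_j tau.  Expanding each exponential at tau
    gives terms alpha_j e^(x_j) (x_j s / tau)^k / k!.  Stirling's lower bound
    k! >= sqrt k (k/e)^k yields |x|^k / k! <= e^|x| / sqrt k, and e^(x_j + |x_j|)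
    equals 1 except for the finitely many negative lambda_j, so it is bounded
    uniformly in j.  The n-th remainder of every exponential is then at most a
    geometric tail of order |s / tau|^n / sqrt n, and summing over j against
    |alpha_j| gives both the expansion and the rate. *)

(** * Stirling's lower bound for the factorial *)

(** The difference of the two sides vanishes at 1 and has derivative (1 - 1/v)^2 / 2. At u = (k+1)/k
    the inequality is sharp enough to leave a telescoping error below. *)
Lemma ln_le_half_sub_inv (u : R) : 1 <= u -> ln u <= (u - / u) / 2.
Proof.
  intros Hu.
  destruct (MVT_gen (fun v => (v - / v) / 2 - ln v) 1 u
              (fun v => (1 + / v ^ 2) / 2 - / v)) as [c [Hc Heq]].
  - intros v Hv. rewrite Rmin_left, Rmax_right in Hv by lra.
    auto_derive; [lra | field; lra].
  - intros v Hv. rewrite Rmin_left, Rmax_right in Hv by lra.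
    apply continuity_pt_filterlim.
    apply (ex_derive_continuous (V := R_NormedModule) (fun v => (v - / v) / 2 - ln v)).
    auto_derive; lra.
  - rewrite Rmin_left, Rmax_right in Hc by lra.
    rewrite ln_1, Rinv_1 in Heq.
    assert (Hd : 0 <= (1 + / c ^ 2) / 2 - / c).
    { replace ((1 + / c ^ 2) / 2 - / c) with ((1 - / c) ^ 2 / 2) by (field; lra).
      apply Rmult_le_pos; [apply pow2_ge_0 | lra]. }
    assert (0 <= ((1 + / c ^ 2) / 2 - / c) * (u - 1))
      by (apply Rmult_le_pos; lra).
    lra.
Qed.

(* [ln k! - (k + 1/2) ln k + k - 1 / (4 k)] is nondecreasing in [k >= 1]. *)
Lemma ln_fact_lower (m : nat) :
  3 / 4 + / (4 * INR (S m)) <=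
  ln (INR (fact (S m))) - (INR (S m) + / 2) * ln (INR (S m)) + INR (S m).
Proof.
  induction m as [|m IH].
  (* Equality holds at k = 1; this fixes the constant 3/4. *)
  - simpl. rewrite ln_1. lra.
  - rewrite fact_simpl, mult_INR, (S_INR (S m)).
    assert (Hk : 0 < INR (S m)) by (apply lt_0_INR; lia).
    assert (Hf : 0 < INR (fact (S m))) by apply INR_fact_lt_0.
    set (k := INR (S m)) in *. set (f := INR (fact (S m))) in *.
    rewrite ln_mult by lra.
    assert (Hl : ln ((k + 1) / k) <= ((k + 1) / k - / ((k + 1) / k)) / 2).
    { apply ln_le_half_sub_inv.
      replace ((k + 1) / k) with (1 + / k) by (field; lra).
      assert (0 < / k) by now apply Rinv_0_lt_compat. lra. }
    rewrite ln_div in Hl by lra.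
    (* The excess over 1 is 1 / (4k(k+1)), exactly the drop of the correction 1/(4k) from k to k +
       1. *)
    assert (Hm : (k + / 2) * (ln (k + 1) - ln k) <=
                 1 + / (4 * k) - / (4 * (k + 1))).
    { replace (1 + / (4 * k) - / (4 * (k + 1)))
        with ((k + / 2) * (((k + 1) / k - / ((k + 1) / k)) / 2))
        by (field; lra).
      apply Rmult_le_compat_l; lra. }
    lra.
Qed.

Lemma exp_mult_INR (x : R) (n : nat) : exp (INR n * x) = exp x ^ n.
Proof.
  induction n as [|n IH].
  - simpl. rewrite Rmult_0_l. apply exp_0.
  - rewrite S_INR, Rmult_plus_distr_r, Rmult_1_l, exp_plus, IH. simpl. ring.
Qed.

(** After taking logarithms this follows from [ln_fact_lower], whose left side is positive. The
    constant is 1 in place of Stirling's sqrt(2 pi). *)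
Lemma fact_lower (n : nat) : (0 < n)%nat ->
  sqrt (INR n) * INR n ^ n <= exp (INR n) * INR (fact n).
Proof.
  intros Hn. destruct n as [|m]; [lia|].
  assert (Hk : 0 < INR (S m)) by (apply lt_0_INR; lia).
  assert (Hf : 0 < INR (fact (S m))) by apply INR_fact_lt_0.
  assert (Hs : 0 < sqrt (INR (S m))) by now apply sqrt_lt_R0.
  assert (Hp : 0 < INR (S m) ^ S m) by now apply pow_lt.
  assert (Hln : ln (INR (S m)) = ln (sqrt (INR (S m))) + ln (sqrt (INR (S m))))
    by (rewrite <- ln_mult, sqrt_sqrt by lra; reflexivity).
  apply Rnot_lt_le. intros Hlt.
  apply ln_increasing in Hlt;
    [| apply Rmult_lt_0_compat; [apply exp_pos | assumption]].
  rewrite !ln_mult, ln_exp, ln_pow in Hlt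
    by (try assumption; apply exp_pos).
  pose proof (ln_fact_lower m) as H.
  assert (0 < / (4 * INR (S m))) by (apply Rinv_0_lt_compat; lra).
  lra.
Qed.

(** * Terms and remainders of the exponential series *)

(** Stirling bounds the maximum over x of x^n e^(-x) / n!. The gain 1/sqrt n, uniform in x, is the
    source of the sqrt n in the final rate. *)
Lemma pow_div_fact_le (x : R) (n : nat) : 0 <= x -> (0 < n)%nat ->
  x ^ n / INR (fact n) <= exp x / sqrt (INR n).
Proof.
  intros Hx Hn.
  assert (Hk : 0 < INR n) by (apply lt_0_INR; lia).
  assert (Hf : 0 < INR (fact n)) by apply INR_fact_lt_0.
  assert (Hs : 0 < sqrt (INR n)) by now apply sqrt_lt_R0.
  (* The maximum of [x ^ n * exp (- x)] is attained at [x = n]. *)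
  assert (Hpow : x ^ n * exp (INR n) <= INR n ^ n * exp x).
  (* The claim becomes the n-th power of x <= n e^(x/n - 1), an instance of 1 + y <= e^y. *)
  { replace (exp x) with (exp (x / INR n - 1) ^ n * exp (INR n))
      by (rewrite <- exp_mult_INR, <- exp_plus; f_equal; field; lra).
    rewrite <- Rmult_assoc, <- Rpow_mult_distr.
    apply Rmult_le_compat_r; [left; apply exp_pos|].
    apply pow_incr. split; [assumption|].
    replace x with (INR n * (x / INR n)) at 1 by (field; lra).
    apply Rmult_le_compat_l; [lra|].
    pose proof (exp_ineq1_le (x / INR n - 1)). lra. }
  pose proof (fact_lower n Hn) as Hst.
  pose proof (exp_pos (INR n)) as He. pose proof (exp_pos x) as Hex.
  assert (H : x ^ n * sqrt (INR n) <= exp x * INR (fact n)).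
  { apply Rmult_le_reg_r with (exp (INR n)); [assumption|].
    apply Rle_trans with (INR n ^ n * exp x * sqrt (INR n)).
    - replace (x ^ n * sqrt (INR n) * exp (INR n))
        with (x ^ n * exp (INR n) * sqrt (INR n)) by ring.
      apply Rmult_le_compat_r; lra.
    - replace (INR n ^ n * exp x * sqrt (INR n))
        with (exp x * (sqrt (INR n) * INR n ^ n)) by ring.
      replace (exp x * INR (fact n) * exp (INR n))
        with (exp x * (exp (INR n) * INR (fact n))) by ring.
      apply Rmult_le_compat_l; lra. }
  apply Rle_div_l; [assumption|].
  replace (exp x / sqrt (INR n) * INR (fact n))
    with (exp x * INR (fact n) / sqrt (INR n)) by (field; lra).
  now apply Rle_div_r.
Qed.

Lemma pow_div_fact_le_exp (x : R) (n : nat) : 0 <= x ->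
  x ^ n / INR (fact n) <= exp x.
Proof.
  intros Hx. destruct n as [|n].
  - simpl. pose proof (exp_ineq1_le x). lra.
  - apply Rle_trans with (exp x / sqrt (INR (S n))).
    + apply pow_div_fact_le; [assumption | lia].
    + assert (H1 : 1 <= sqrt (INR (S n))).
      { rewrite <- sqrt_1 at 1. apply sqrt_le_1_alt.
        rewrite S_INR. pose proof (pos_INR n). lra. }
      apply Rle_div_l; [lra|].
      pose proof (exp_pos x). rewrite <- (Rmult_1_r (exp x)) at 1.
      apply Rmult_le_compat_l; lra.
Qed.

(** Each tail term splits into |x|^m / m!, at most e^|x| / sqrt n for m > n, and |r|^m, which is
    summed geometrically. Keeping x apart from r makes the decay in n independent of x, later
    [- lambda j * tau]. *)
Lemma exp_taylor_remainder (x r : R) (n : nat) : (0 < n)%nat -> Rabs r < 1 ->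
  Rabs (exp (x * r) - sum_n (fun k => (x * r) ^ k / INR (fact k)) n) <=
  exp (Rabs x) / sqrt (INR n) * (Rabs r ^ n * / (1 - Rabs r)).
Proof.
  intros Hn Hr.
  assert (Hs : 0 < sqrt (INR n)) by (apply sqrt_lt_R0, lt_0_INR; lia).
  pose proof (Rabs_pos r) as Hr0.
  assert (Hexp : is_series (fun k => (x * r) ^ k / INR (fact k)) (exp (x * r))).
  { generalize (is_exp_Reals (x * r)). intros H. apply is_pseries_R in H.
    eapply is_series_ext; [| exact H].
    intros k. simpl. unfold Rdiv. apply Rmult_comm. }
  set (u := fun k => (x * r) ^ k / INR (fact k)) in *.
  assert (Htail : is_series (fun k => u (S n + k)%nat) (exp (x * r) - sum_n u n)).
  { apply (is_series_incr_n u (S n)); [lia|].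
    replace (plus _ _) with (exp (x * r)); [exact Hexp|].
    change (exp (x * r) = exp (x * r) - sum_n u n + sum_n u n). ring. }
  set (B := exp (Rabs x) / sqrt (INR n)).
  assert (Hterm : forall k, Rabs (u (S n + k)%nat) <=
                            B * Rabs r ^ n * Rabs r ^ k).
  { intros k. unfold u.
    rewrite Rabs_div by apply INR_fact_neq_0.
    rewrite (Rabs_pos_eq (INR _)) by apply pos_INR.
    rewrite <- RPow_abs, Rabs_mult, Rpow_mult_distr.
    set (m := (S n + k)%nat).
    assert (Hm : (n <= m)%nat) by (unfold m; lia).
    replace (Rabs x ^ m * Rabs r ^ m / INR (fact m))
      with (Rabs x ^ m / INR (fact m) * Rabs r ^ m)
      by (field; apply INR_fact_neq_0).
    rewrite Rmult_assoc, <- pow_add.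
    apply Rmult_le_compat.
    - apply Rdiv_le_0_compat; [apply pow_le, Rabs_pos | apply INR_fact_lt_0].
    - apply pow_le, Hr0.
    - apply Rle_trans with (exp (Rabs x) / sqrt (INR m)).
      + apply pow_div_fact_le; [apply Rabs_pos | lia].
      + apply Rmult_le_compat_l; [left; apply exp_pos|].
        apply Rinv_le_contravar; [assumption|].
        apply sqrt_le_1_alt, le_INR, Hm.
    (* The tail starts at n + 1; the spare factor |r| < 1 is discarded. *)
    - unfold m. replace (S n + k)%nat with (S (n + k)) by lia. simpl.
      rewrite <- (Rmult_1_l (Rabs r ^ (n + k))) at 2.
      apply Rmult_le_compat_r; [apply pow_le, Hr0 | lra]. }
  assert (Hgeom : is_series (fun k => B * Rabs r ^ n * Rabs r ^ k)
                    (B * Rabs r ^ n * / (1 - Rabs r))).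
  { apply (is_series_scal (V := R_NormedModule)), is_series_geom.
    now rewrite Rabs_Rabsolu. }
  rewrite <- (is_series_unique _ _ Htail).
  eapply Rle_trans.
  - apply Series_Rabs.
    apply (ex_series_le (V := R_CompleteNormedModule)) with (2 := ex_intro _ _ Hgeom).
    intros k. change (norm ?a) with (Rabs a). rewrite Rabs_Rabsolu. apply Hterm.
  - rewrite <- Rmult_assoc, <- (is_series_unique _ _ Hgeom).
    apply Series_le; [| eexists; exact Hgeom].
    intros k. split; [apply Rabs_pos | apply Hterm].
Qed.

(** * Uniform bounds in j and series with bounded weights *)

Lemma bounded_off_finite (u : nat -> R) (c : R) (F : list nat) :
  (forall j, ~ In j F -> u j <= c) -> exists M, forall j, u j <= M.
Proof.
  revert c. induction F as [|a F IH]; intros c H.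
  - exists c. intros j. now apply H.
  - apply (IH (Rmax c (u a))). intros j Hj.
    destruct (Nat.eq_dec a j) as [<-|Hne]; [apply Rmax_r|].
    apply Rle_trans with c; [| apply Rmax_l].
    apply H. now intros [|].
Qed.

(** When lambda_j > 0 the two exponents cancel and the product is 1; the finitely many other indices
    only enlarge M. This absorbs the factor e^|x| of the remainder bound. *)
Lemma exp_plus_abs_bounded (lambda : nat -> R) (t : R) : 0 <= t ->
  (exists F : list nat, forall j : nat, ~ In j F -> 0 < lambda j) ->
  exists M, forall j,
    exp (- lambda j * t) * exp (Rabs (- lambda j * t)) <= M.
Proof.
  intros Ht [F HF].
  apply (bounded_off_finite _ 1 F). intros j Hj. specialize (HF j Hj).
  rewrite <- exp_plus, <- exp_0. apply Req_le. f_equal.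
  rewrite Rabs_left1; [ring|].
  assert (0 <= lambda j * t) by (apply Rmult_le_pos; lra). lra.
Qed.

Lemma ex_series_mult_bounded (a w : nat -> R) (M : R) :
  ex_series (fun j => Rabs (a j)) -> (forall j, Rabs (w j) <= M) ->
  ex_series (fun j => a j * w j).
Proof.
  intros Ha Hw.
  apply (ex_series_le (V := R_CompleteNormedModule)) with (fun j => Rabs (a j) * M).
  - intros j. change (norm ?z) with (Rabs z). rewrite Rabs_mult.
    apply Rmult_le_compat_l; [apply Rabs_pos | apply Hw].
  - now apply (ex_series_scal_r M).
Qed.

Lemma Series_mult_bounded (a w : nat -> R) (M : R) :
  ex_series (fun j => Rabs (a j)) -> (forall j, Rabs (w j) <= M) ->
  Rabs (Series (fun j => a j * w j)) <= Series (fun j => Rabs (a j)) * M.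
Proof.
  intros Ha Hw.
  rewrite <- Series_scal_r.
  assert (H : forall j, Rabs (a j * w j) <= Rabs (a j) * M).
  { intros j. rewrite Rabs_mult.
    apply Rmult_le_compat_l; [apply Rabs_pos | apply Hw]. }
  assert (HaM : ex_series (fun j => Rabs (a j) * M))
    by now apply (ex_series_scal_r M).
  eapply Rle_trans.
  - apply Series_Rabs.
    apply (ex_series_le (V := R_CompleteNormedModule)) with (2 := HaM).
    intros j. change (norm ?z) with (Rabs z). rewrite Rabs_Rabsolu. apply H.
  - apply Series_le; [| exact HaM].
    intros j. split; [apply Rabs_pos | apply H].
Qed.

(** Only partial sums over the degree k are exchanged with the sum over j; the limit in k will come
    from the remainder estimate. *)
Lemma is_series_sum_n (u : nat -> nat -> R) (l : nat -> R) (n : nat) :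
  (forall k, is_series (u k) (l k)) ->
  is_series (fun j => sum_n (fun k => u k j) n) (sum_n l n).
Proof.
  intros H. induction n as [|n IH].
  - rewrite sum_O. eapply is_series_ext; [| apply (H 0%nat)].
    intros j. now rewrite sum_O.
  - rewrite sum_Sn. eapply is_series_ext;
      [| apply (is_series_plus (V := R_NormedModule) _ _ _ _ IH (H (S n)))].
    intros j. now rewrite sum_Sn.
Qed.

(** * Taylor expansion of [phi] at tau *)

Section Expansion.

Variables lambda alpha : nat -> R.
Hypothesis hlambda :
  exists F : list nat, forall j : nat, ~ In j F -> 0 < lambda j.
Hypothesis halpha : ex_series (fun j : nat => Rabs (alpha j)).

Lemma ex_series_phi (t : R) : 0 <= t ->
  ex_series (fun j => alpha j * exp (- lambda j * t)).
Proof.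
  intros Ht. destruct (exp_plus_abs_bounded lambda t Ht hlambda) as [M HM].
  apply ex_series_mult_bounded with M; [exact halpha|].
  intros j. rewrite Rabs_pos_eq by (left; apply exp_pos).
  eapply Rle_trans; [| apply HM].
  pose proof (exp_pos (- lambda j * t)).
  pose proof (exp_ineq1_le (Rabs (- lambda j * t))).
  pose proof (Rabs_pos (- lambda j * t)).
  rewrite <- (Rmult_1_r (exp (- lambda j * t))) at 1.
  apply Rmult_le_compat_l; lra.
Qed.

Lemma ex_series_taylor_term (tau : R) (n : nat) : 0 < tau ->
  ex_series (taylor_term alpha lambda tau n).
Proof.
  intros Ht.
  destruct (exp_plus_abs_bounded lambda tau (Rlt_le _ _ Ht) hlambda) as [M HM].
  apply ex_series_ext with (fun j => alpha j *
    (exp (- lambda j * tau) * ((- lambda j) ^ n / INR (fact n)))).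
  { intros j. symmetry. apply Rmult_assoc. }
  assert (Hp : 0 < tau ^ n) by now apply pow_lt.
  (* Multiplying |lambda_j|^n / n! by tau^n gives |lambda_j tau|^n / n!, at most e^|lambda_j tau|,
     which M controls together with the weight. *)
  apply ex_series_mult_bounded with (M / tau ^ n); [exact halpha|].
  intros j. apply Rle_div_r; [assumption|].
  eapply Rle_trans; [| apply (HM j)].
  rewrite Rabs_mult, (Rabs_pos_eq (exp _)) by (left; apply exp_pos).
  rewrite Rmult_assoc. apply Rmult_le_compat_l; [left; apply exp_pos|].
  rewrite Rabs_div by apply INR_fact_neq_0.
  rewrite (Rabs_pos_eq (INR _)) by apply pos_INR.
  eapply Rle_trans;
    [| apply (pow_div_fact_le_exp (Rabs (- lambda j * tau)) n), Rabs_pos].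
  rewrite Rabs_mult, Rpow_mult_distr, (Rabs_pos_eq tau), RPow_abs by lra.
  apply Req_le. field. apply INR_fact_neq_0.
Qed.

Lemma phi_taylor_remainder (tau t : R) : 0 < tau -> 0 < t < 2 * tau ->
  exists C, forall n, (0 < n)%nat ->
    Rabs (phi alpha lambda t
          - sum_n (fun k => taylor_coef alpha lambda tau k * (t - tau) ^ k) n)
    <= C * (Rabs ((t - tau) / tau) ^ n / sqrt (INR n)).
Proof.
  intros Htau Ht.
  destruct (exp_plus_abs_bounded lambda tau (Rlt_le _ _ Htau) hlambda) as [M HM].
  set (r := (t - tau) / tau).
  assert (Hr : Rabs r < 1).
  { apply Rabs_def1; [apply Rlt_div_l; lra | apply Rlt_div_r; lra]. }
  (* Total mass of alpha, uniform bound on the exponential weights, and sum of the geometric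
     series. *)
  exists (Series (fun j => Rabs (alpha j)) * (M * / (1 - Rabs r))).
  intros n Hn.
  assert (Hs : 0 < sqrt (INR n)) by (apply sqrt_lt_R0, lt_0_INR; lia).
  (* Since tau + tau r = t, [w j] is the order-n Taylor remainder at tau of e^(-lambda_j t). *)
  set (w := fun j => exp (- lambda j * tau) *
    (exp (- lambda j * tau * r)
     - sum_n (fun k => (- lambda j * tau * r) ^ k / INR (fact k)) n)).
  assert (Hsum : is_series
     (fun j => sum_n (fun k => taylor_term alpha lambda tau k j * (t - tau) ^ k) n)
     (sum_n (fun k => taylor_coef alpha lambda tau k * (t - tau) ^ k) n)).
  { apply (is_series_sum_n
             (fun k j => taylor_term alpha lambda tau k j * (t - tau) ^ k)
             (fun k => taylor_coef alpha lambda tau k * (t - tau) ^ k)).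
    intros k. apply (is_series_scal_r ((t - tau) ^ k)).
    now apply Series_correct, ex_series_taylor_term. }
  assert (Hphi : phi alpha lambda t
          - sum_n (fun k => taylor_coef alpha lambda tau k * (t - tau) ^ k) n
          = Series (fun j => alpha j * w j)).
  { unfold phi. rewrite <- (is_series_unique _ _ Hsum), <- Series_minus;
      [| apply ex_series_phi; lra | eexists; exact Hsum].
    apply Series_ext. intros j. unfold w.
    rewrite !Rmult_minus_distr_l, <- exp_plus.
    f_equal; [f_equal; f_equal; unfold r; field; lra|].
    rewrite <- !(sum_n_mult_l (K := R_Ring)). apply sum_n_ext. intros k.
    unfold mult, taylor_term; simpl.
    replace (- lambda j * tau * r) with (- lambda j * (t - tau))
      by (unfold r; field; lra).
    rewrite (Rpow_mult_distr (- lambda j)). field. apply INR_fact_neq_0. }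
  rewrite Hphi.
  replace (Series (fun j => Rabs (alpha j)) * (M * / (1 - Rabs r)) *
           (Rabs r ^ n / sqrt (INR n)))
    with (Series (fun j => Rabs (alpha j)) *
          (M * (/ sqrt (INR n) * (Rabs r ^ n * / (1 - Rabs r)))))
    by (field; lra).
  apply Series_mult_bounded; [exact halpha|].
  intros j. unfold w.
  rewrite Rabs_mult, (Rabs_pos_eq (exp _)) by (left; apply exp_pos).
  eapply Rle_trans.
  - apply Rmult_le_compat_l; [left; apply exp_pos|].
    now apply exp_taylor_remainder.
  - unfold Rdiv. rewrite (Rmult_assoc (exp (Rabs _))), <- Rmult_assoc.
    apply Rmult_le_compat_r; [| apply HM].
    apply Rmult_le_pos; [left; now apply Rinv_0_lt_compat|].
    apply Rmult_le_pos; [apply pow_le, Rabs_pos|].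
    left. apply Rinv_0_lt_compat. lra.
Qed.

Lemma phi_is_pseries (tau t : R) : 0 < tau -> 0 < t < 2 * tau ->
  is_pseries (taylor_coef alpha lambda tau) (t - tau) (phi alpha lambda t).
Proof.
  intros Htau Ht.
  destruct (phi_taylor_remainder tau t Htau Ht) as [C HC].
  set (r := (t - tau) / tau) in *.
  assert (Hr : Rabs r < 1).
  { apply Rabs_def1; [apply Rlt_div_l; lra | apply Rlt_div_r; lra]. }
  apply is_pseries_R.
  set (S_ := sum_n (fun k => taylor_coef alpha lambda tau k * (t - tau) ^ k)) in *.
  enough (H : is_lim_seq S_ (phi alpha lambda t)) by exact H.
  assert (Hd : is_lim_seq (fun n => phi alpha lambda t - S_ n) 0).
  { apply is_lim_seq_abs_0.
    (* The sign of C is unknown, hence |C|; the factor 1/sqrt n is bounded by 1 for n >= 1. *)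
    apply is_lim_seq_le_le_loc with (fun _ => 0) (fun n => Rabs C * Rabs r ^ n).
    - exists 1%nat. intros n Hn. split; [apply Rabs_pos|].
      eapply Rle_trans; [apply HC; lia|].
      apply Rle_trans with (Rabs C * (Rabs r ^ n / sqrt (INR n))).
      + assert (Hs : 0 < sqrt (INR n)) by (apply sqrt_lt_R0, lt_0_INR; lia).
        apply Rmult_le_compat_r; [| apply Rle_abs].
        apply Rdiv_le_0_compat; [apply pow_le, Rabs_pos | assumption].
      + apply Rmult_le_compat_l; [apply Rabs_pos|].
        assert (1 <= sqrt (INR n)).
        { rewrite <- sqrt_1 at 1. apply sqrt_le_1_alt. now apply (le_INR 1). }
        apply Rle_div_l; [lra|].
        assert (0 <= Rabs r ^ n) by apply pow_le, Rabs_pos.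
        rewrite <- (Rmult_1_r (Rabs r ^ n)) at 1.
        apply Rmult_le_compat_l; lra.
    - apply is_lim_seq_const.
    - replace (Finite 0) with (Rbar_mult (Rabs C) 0)
        by (simpl; now rewrite Rmult_0_r).
      apply is_lim_seq_scal_l, is_lim_seq_geom. now rewrite Rabs_Rabsolu. }
  apply is_lim_seq_ext with (fun n => phi alpha lambda t - (phi alpha lambda t - S_ n)).
  { intros n. ring. }
  replace (Finite (phi alpha lambda t)) with (Finite (phi alpha lambda t - 0))
    by (f_equal; ring).
  apply is_lim_seq_minus'; [apply is_lim_seq_const | exact Hd].
Qed.

Lemma phi_real_analytic : real_analytic_on 0 p_infty (phi alpha lambda).
Proof.
  intros x0 Hx0 _. simpl in Hx0.
  (* With tau = x0, the ball of radius x0 about x0 is exactly (0, 2 x0). *)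
  exists (taylor_coef alpha lambda x0), (mkposreal x0 Hx0).
  intros x Hx. apply phi_is_pseries; [assumption|].
  apply Rabs_lt_between' in Hx. simpl in Hx. lra.
Qed.

End Expansion.

Theorem mainTheorem1 (lambda alpha : nat -> R)
  (hlambda : exists F : list nat, forall j : nat, ~ In j F -> 0 < lambda j)
  (halpha : ex_series (fun j : nat => Rabs (alpha j))) :
  (forall t : R, 0 <= t ->
     ex_series (fun j : nat => alpha j * exp (- lambda j * t))) /\
  real_analytic_on 0 p_infty (phi alpha lambda) /\
  (forall tau : R, 0 < tau ->
     (forall n : nat, ex_series (taylor_term alpha lambda tau n)) /\
     (forall t : R, 0 < t < 2 * tau ->
        is_pseries (taylor_coef alpha lambda tau) (t - tau)
          (phi alpha lambda t))) /\
  (forall tau : R, 0 < tau -> forall t : R, 0 < t < 2 * tau ->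
     bigO_seq
       (fun n : nat =>
          Rabs (phi alpha lambda t
                - sum_n (fun j => taylor_coef alpha lambda tau j
                                  * (t - tau) ^ j) n))
       (fun n : nat => Rabs (t - tau) ^ n / (tau ^ n * sqrt (INR n)))).
Proof.
  split; [| split; [| split]].
  - now apply ex_series_phi.
  - now apply phi_real_analytic.
  - intros tau Htau. split.
    + intros n. now apply ex_series_taylor_term.
    + intros t Ht. now apply phi_is_pseries.
  - intros tau Htau t Ht.
    destruct (phi_taylor_remainder lambda alpha hlambda halpha tau t Htau Ht)
      as [C HC].
    (* Starting at n = 1 avoids dividing by sqrt 0; from there on the two bounds are equal. *)
    exists C. exists 1%nat. intros n Hn.
    assert (Hp : 0 < tau ^ n) by now apply pow_lt.
    assert (Hs : 0 < sqrt (INR n)) by (apply sqrt_lt_R0, lt_0_INR; lia).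
    rewrite Rabs_Rabsolu.
    eapply Rle_trans; [apply HC; lia|]. apply Req_le. f_equal.
    rewrite (Rabs_pos_eq (_ / (_ * _))).
    + rewrite Rabs_div, (Rabs_pos_eq tau) by lra. unfold Rdiv.
      rewrite Rpow_mult_distr, pow_inv. field; split; lra.
    + apply Rdiv_le_0_compat; [apply pow_le, Rabs_pos|].
      now apply Rmult_lt_0_compat.
Qed.
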